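(* Let $X$ be a rack with structure group $G_X$, and let $A$ be an abelian group regarded as a trivial $G_X$-module. Then $H^2(X,A)\simeq H^1(G_X,\mathrm{Fun}(X,A))$, where the left side is rack cohomology and the right side is group cohomology of $G_X$ with coefficients in the right $G_X$-module $\mathrm{Fun}(X,A)$ of functions $X\to A$, with action determined by $(h\cdot y)(x)=h(y\triangleright x)$ for $h\in \mathrm{Fun}(X,A)$, $x,y\in X$.
   Context: A rack is a set $X$ with a binary operation $\triangleright$ such that $y\mapsto x\triangleright y$ is a bijection of $X$ for every $x\in X$, and $x\triangleright(y\triangleright z)=(x\triangleright y)\triangleright(x\triangleright z)$ for all $x,y,z\in X$. Its structure group $G_X$ is the group generated by the elements of $X$ with relations $xy=(x\triangleright y)x$ for $x,y\in X$. For an abelian group $A$ with trivial $G_X$-action, the rack cohomology $H^\bullet(X,A)$ is the cohomology of the complex $C^n(X,A)=\mathrm{Fun}(X^n,A)$, $n\ge0$ (functions $X^n\to A$, $X^0$ a one-point set), with differential $$df(x_1,\ldots,x_{n+1})=\sum_{i=1}^{n+1}(-1)^{i-1}\Big(f(x_1,\ldots,x_{i-1},x_{i+1},\ldots,x_{n+1})-f(x_1,\ldots,x_{i-1},x_i\triangleright x_{i+1},\ldots,x_i\triangleright x_{n+1})\Big).$$ For a right $G$-module $M$, a group $1$-cocycle is a map $\pi:G\to M$ with $\pi(gh)=\pi(g)\cdot h+\pi(h)$, and coboundaries are the maps $g\mapsto v-v\cdot g$, $v\in M$. *)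

(* Defs.v *)
From HB Require Import structures.
From mathcomp Require Import all_boot all_order all_algebra.
From mathcomp Require Export boolp functions.
From mathcomp Require Import generic_quotient ring_quotient.

Set Implicit Arguments.
Unset Strict Implicit.
Unset Printing Implicit Defensive.

Import GRing.Theory.

Local Open Scope ring_scope.
Local Open Scope quotient_scope.

HB.mixin Record isRack (X : Type) := {
  rop : X -> X -> X;
  rop_bij : forall x, bijective (rop x);
  ropD : forall x y z, rop x (rop y z) = rop (rop x y) (rop x z)
}.

#[short(type="rackType")]
HB.structure Definition Rack := {X of isRack X}.

Declare Scope rack_scope.
Delimit Scope rack_scope with rack.
Local Open Scope rack_scope.
Notation "x ▷ y" := (rop x y)
  (at level 40, left associativity) : rack_scope.

Section LeftTranslationInverse.
Variables (X : rackType) (x : X).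

Lemma rinv_subproof : exists g : X -> X, cancel (rop x) g /\ cancel g (rop x).
Proof. by have [g ? ?] := rop_bij x; exists g. Qed.

Definition rinv : X -> X := sval (cid rinv_subproof).

Lemma ropK : cancel (rop x) rinv.
Proof. by rewrite /rinv; case: cid => g []. Qed.

Lemma rinvK : cancel rinv (rop x).
Proof. by rewrite /rinv; case: cid => g []. Qed.

End LeftTranslationInverse.

(* A letter (true, x) stands for the generator x and (false, x) for x^-1.     *)
Definition word (X : Type) : Type := {classic seq (bool * X)}.

Definition winv (X : Type) (w : seq (bool * X)) : seq (bool * X) :=
  rev [seq (~~ l.1, l.2) | l <- w].

Inductive sg_congr (X : rackType) : seq (bool * X) -> seq (bool * X) -> Prop :=
| SgRefl u : sg_congr u u
| SgSym u v : sg_congr u v -> sg_congr v u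
| SgTrans u v w : sg_congr u v -> sg_congr v w -> sg_congr u w
| SgCat u u' v v' :
    sg_congr u u' -> sg_congr v v' -> sg_congr (u ++ v) (u' ++ v')
| SgCancel (b : bool) (x : X) : sg_congr [:: (b, x); (~~ b, x)] [::]
| SgRack (x y : X) :
    sg_congr [:: (true, x); (true, y)] [:: (true, x ▷ y); (true, x)].

Section StructureGroup.
Variable X : rackType.
Implicit Types u v w : seq (bool * X).

Definition sg_rel : rel (word X) := fun u v => `[< sg_congr u v >].

Lemma sg_rel_equiv : equiv_class_of sg_rel.
Proof.
split=> [u|u v|v u w]; first by apply/asboolP; exact: SgRefl.
  by apply/asboolP/asboolP; exact: SgSym.
by move=> /asboolP uv /asboolP vw; apply/asboolP; exact: SgTrans uv vw.
Qed.

Canonical sg_rel_equivRel := EquivRelPack sg_rel_equiv.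
Canonical sg_rel_encModRel := defaultEncModRel sg_rel.

Definition structure_group : Type := {eq_quot sg_rel}.

HB.instance Definition _ : EqQuotient (word X) sg_rel structure_group :=
  EqQuotient.on structure_group.
HB.instance Definition _ := Choice.on structure_group.

Definition sg_class w : structure_group := \pi_structure_group (w : word X).
Definition sg_word (g : structure_group) : seq (bool * X) := repr g.

Lemma sg_classP u v : sg_class u = sg_class v <-> sg_congr u v.
Proof.
split; first by move/eqmodP/asboolP.
by move=> uv; apply/eqmodP/asboolP.
Qed.

Lemma sg_wordK : cancel sg_word sg_class.
Proof. by move=> g; exact: reprK. Qed.

Lemma sg_congr_word w : sg_congr (sg_word (sg_class w)) w.
Proof. by apply/sg_classP; rewrite sg_wordK. Qed.

Lemma winvD u v : winv (u ++ v) = winv v ++ winv u.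
Proof. by rewrite /winv map_cat rev_cat. Qed.

Lemma winvK : involutive (@winv X).
Proof.
move=> u; rewrite /winv map_rev revK -map_comp -[RHS]map_id.
by apply: eq_map => -[b x] /=; rewrite negbK.
Qed.

Lemma sg_congr_mulV w : sg_congr (w ++ winv w) [::].
Proof.
elim: w => [|[b x] w IHw]; first exact: SgRefl.
rewrite -cat1s winvD catA -(catA [:: _]).
apply: SgTrans (SgCancel b x).
rewrite -[X in sg_congr _ X]/([:: (b, x)] ++ [:: (~~ b, x)]).
apply: SgCat (SgRefl _); rewrite -[X in sg_congr _ X]cats0.
exact: SgCat (SgRefl _) IHw.
Qed.

Lemma sg_congr_mulVl w : sg_congr (winv w ++ w) [::].
Proof. by have := sg_congr_mulV (winv w); rewrite winvK. Qed.

Lemma sg_congr_inv u v : sg_congr u v -> sg_congr (winv u) (winv v).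
Proof.
move=> uv.
have h1 : sg_congr (winv u) (winv u ++ (v ++ winv v)).
  rewrite -[X in sg_congr X _]cats0.
  exact: SgCat (SgRefl _) (SgSym (sg_congr_mulV v)).
apply: SgTrans h1 _; rewrite catA -[X in sg_congr _ X]cat0s.
apply: SgCat (SgRefl _).
apply: SgTrans (sg_congr_mulVl u).
exact: SgCat (SgRefl _) (SgSym uv).
Qed.

Definition sg_one : structure_group := sg_class [::].
Definition sg_mul (g h : structure_group) : structure_group :=
  sg_class (sg_word g ++ sg_word h).
Definition sg_inv (g : structure_group) : structure_group :=
  sg_class (winv (sg_word g)).

Lemma sg_mulE u v : sg_mul (sg_class u) (sg_class v) = sg_class (u ++ v).
Proof. by apply/sg_classP; apply: SgCat; exact: sg_congr_word. Qed.

Lemma sg_invE u : sg_inv (sg_class u) = sg_class (winv u).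
Proof. by apply/sg_classP/sg_congr_inv; exact: sg_congr_word. Qed.

Lemma sg_mulA : associative sg_mul.
Proof.
move=> g h k; rewrite -(sg_wordK g) -(sg_wordK h) -(sg_wordK k).
by rewrite !sg_mulE catA.
Qed.

Lemma sg_mul1g : left_id sg_one sg_mul.
Proof. by move=> g; rewrite -(sg_wordK g) sg_mulE. Qed.

Lemma sg_mulg1 : right_id sg_one sg_mul.
Proof. by move=> g; rewrite -(sg_wordK g) sg_mulE cats0. Qed.

Lemma sg_mulVg : left_inverse sg_one sg_inv sg_mul.
Proof.
move=> g; rewrite -(sg_wordK g) sg_invE sg_mulE.
by apply/sg_classP; exact: sg_congr_mulVl.
Qed.

Lemma sg_mulgV : right_inverse sg_one sg_inv sg_mul.
Proof.
move=> g; rewrite -(sg_wordK g) sg_invE sg_mulE.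
by apply/sg_classP; exact: sg_congr_mulV.
Qed.

HB.instance Definition _ :=
  isGroup.Build structure_group sg_mulA sg_mul1g sg_mulg1 sg_mulVg sg_mulgV.

Definition sg_gen (x : X) : structure_group := sg_class [:: (true, x)].

Lemma sg_gen_rel x y :
  (sg_gen x * sg_gen y = sg_gen (x ▷ y) * sg_gen x)%g.
Proof.
rewrite /sg_gen [LHS]sg_mulE [RHS]sg_mulE.
by apply/sg_classP; exact: SgRack.
Qed.

(* The left action of the structure group on X in which the generator y acts  *)
(* by z |-> y ▷ z.                                                            *)
Definition word_act w (z : X) : X :=
  foldr (fun l t => if l.1 then l.2 ▷ t else rinv l.2 t) z w.

Lemma word_act_congr u v : sg_congr u v -> word_act u =1 word_act v.
Proof.
rewrite /word_act.
elim=> {u v} [||u v w _ uv _ vw z|u u' v v' _ uu' _ vv' z|b x z|x y z] //=.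
- by move=> u v _ uv z.
- by rewrite uv vw.
- by rewrite !foldr_cat vv' uu'.
- by case: b => /=; rewrite ?rinvK ?ropK.
- by rewrite ropD.
Qed.

Definition sg_act (g : structure_group) : X -> X := word_act (sg_word g).

Lemma sg_actE w : sg_act (sg_class w) =1 word_act w.
Proof. by apply: word_act_congr; exact: sg_congr_word. Qed.

Lemma sg_act1 z : sg_act 1%g z = z.
Proof. exact: sg_actE. Qed.

Lemma sg_actM g h z : sg_act (g * h)%g z = sg_act g (sg_act h z).
Proof. by rewrite [LHS]sg_actE /word_act foldr_cat. Qed.

Lemma sg_act_gen y z : sg_act (sg_gen y) z = y ▷ z.
Proof. exact: sg_actE. Qed.

End StructureGroup.

(* The subquotient Z / (Z :&: B) of an abelian group V. In both uses below B  *)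
(* is contained in Z, i.e. cocycles modulo coboundaries.                      *)
Section Subquotient.
Variables (V : zmodType) (Z B : zmodClosed V).

Record subgroup_of : Type := SubgroupOf {
  subgroup_val :> V;
  _ : subgroup_val \in Z
}.
HB.instance Definition _ := [isSub for subgroup_val].
HB.instance Definition _ := [Choice of subgroup_of by <:].
HB.instance Definition _ := [SubChoice_isSubZmodule of subgroup_of by <:].

Definition subgroup_rel : {pred subgroup_of} := [pred z | val z \in B].

Lemma subgroup_rel_closed : zmod_closed subgroup_rel.
Proof.
by split=> [|x y]; rewrite !inE ?raddf0 ?rpred0 // => ? ?; rewrite raddfB rpredB.
Qed.
HB.instance Definition _ :=
  GRing.isZmodClosed.Build subgroup_of subgroup_rel subgroup_rel_closed.

Definition subquotient : zmodType := Quotient.quot subgroup_rel.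

End Subquotient.

Section RackCohomology.
Variables (X : rackType) (A : zmodType).

Definition cochain (n : nat) : zmodType := ('I_n -> X) -> A.

Definition face0 n (i : 'I_n.+1) (x : 'I_n.+1 -> X) : 'I_n -> X :=
  fun j => x (lift i j).

Definition face1 n (i : 'I_n.+1) (x : 'I_n.+1 -> X) : 'I_n -> X :=
  fun j => if (j < i)%N then x (lift i j) else x i ▷ x (lift i j).

(* The sign (-1)^(i-1) becomes (-1)^i because indices start at 0.             *)
Definition rack_d n (f : cochain n) : cochain n.+1 := fun x =>
  \sum_(i < n.+1) (f (face0 i x) - f (face1 i x)) *~ ((-1) ^+ i).

Definition rack_cocycle n : {pred cochain n} :=
  fun f => `[< rack_d f = 0 >].

Definition rack_coboundary n : {pred cochain n} :=
  match n with
  | 0 => fun f => `[< f = 0 >]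
  | m.+1 => fun f => `[< exists g : cochain m, f = rack_d g >]
  end.

Lemma rack_dB n (f g : cochain n) : rack_d (f - g) = rack_d f - rack_d g.
Proof.
apply/funext => x.
rewrite -[RHS]/(rack_d f x - rack_d g x) /rack_d -sumrB.
apply: eq_bigr => i _.
rewrite -mulrzBl; congr (_ *~ _).
rewrite -[(f - g) (face0 i x)]/(f (face0 i x) - g (face0 i x)).
rewrite -[(f - g) (face1 i x)]/(f (face1 i x) - g (face1 i x)).
by rewrite !opprD addrACA.
Qed.

Lemma rack_d0 n : rack_d (0 : cochain n) = 0.
Proof. by rewrite -[X in rack_d X](subrr 0) rack_dB subrr. Qed.

Lemma rack_cocycle_closed n : zmod_closed (@rack_cocycle n).
Proof.
split=> [|f g /asboolP df /asboolP dg]; apply/asboolP; first exact: rack_d0.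
by rewrite rack_dB df dg subrr.
Qed.
HB.instance Definition _ n :=
  GRing.isZmodClosed.Build (cochain n) (@rack_cocycle n)
    (@rack_cocycle_closed n).

Lemma rack_coboundary_closed n : zmod_closed (@rack_coboundary n).
Proof.
case: n => [|n]; split.
- exact/asboolP.
- by move=> f g /asboolP -> /asboolP ->; apply/asboolP; rewrite subrr.
- by apply/asboolP; exists 0; rewrite rack_d0.
- move=> f g /asboolP[f' ->] /asboolP[g' ->]; apply/asboolP.
  by exists (f' - g'); rewrite rack_dB.
Qed.
HB.instance Definition _ n :=
  GRing.isZmodClosed.Build (cochain n) (@rack_coboundary n)
    (@rack_coboundary_closed n).

Definition rack_cohomology (n : nat) : zmodType :=
  subquotient (@rack_cocycle n) (@rack_coboundary n).

End RackCohomology.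

Record rightModule (G : groupType) : Type := RightModule {
  rm_sort :> zmodType;
  rm_act : rm_sort -> G -> rm_sort;
  rm_actD : forall v w g, rm_act (v + w) g = rm_act v g + rm_act w g;
  rm_act1 : forall v, rm_act v 1%g = v;
  rm_actM : forall v g h, rm_act v (g * h)%g = rm_act (rm_act v g) h
}.

Section GroupH1.
Variables (G : groupType) (M : rightModule G).

Definition group_cocycle1 : {pred G -> M} :=
  fun p => `[< forall g h, p (g * h)%g = rm_act (p g) h + p h >].

Definition group_coboundary1 : {pred G -> M} :=
  fun p => `[< exists v : M, forall g, p g = v - rm_act v g >].

Lemma rm_actB (v w : M) g : rm_act (v - w) g = rm_act v g - rm_act w g.
Proof. by apply: (addIr (rm_act w g)); rewrite -rm_actD !subrK. Qed.

Lemma rm_act0 g : rm_act (0 : M) g = 0.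
Proof. by rewrite -[X in rm_act X](subrr 0) rm_actB subrr. Qed.

Lemma group_cocycle1_closed : zmod_closed group_cocycle1.
Proof.
split=> [|p q /asboolP pM /asboolP qM]; apply/asboolP => g h.
  by rewrite -![(0 : G -> M) _]/(0 : M) rm_act0 addr0.
rewrite -![(p - q) _]/(p _ - q _) pM qM rm_actB.
by rewrite opprD addrACA.
Qed.
HB.instance Definition _ :=
  GRing.isZmodClosed.Build (G -> M) group_cocycle1 group_cocycle1_closed.

Lemma group_coboundary1_closed : zmod_closed group_coboundary1.
Proof.
split=> [|p q /asboolP[v pv] /asboolP[w qw]]; apply/asboolP.
  by exists 0 => g; rewrite rm_act0 subrr.
exists (v - w) => g; rewrite -[(p - q) g]/(p g - q g) pv qw rm_actB.
by rewrite !opprD !opprK addrACA.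
Qed.
HB.instance Definition _ :=
  GRing.isZmodClosed.Build (G -> M) group_coboundary1 group_coboundary1_closed.

Definition group_H1 : zmodType := subquotient group_cocycle1 group_coboundary1.

End GroupH1.

Section FunctionModule.
Variables (X : rackType) (A : zmodType).

Definition fun_act (h : X -> A) (g : structure_group X) : X -> A :=
  fun x => h (sg_act g x).

Lemma fun_actD h k g : fun_act (h + k) g = fun_act h g + fun_act k g.
Proof. by []. Qed.

Lemma fun_act1 h : fun_act h 1%g = h.
Proof. by apply/funext => x; rewrite /fun_act sg_act1. Qed.

Lemma fun_actM h g g' : fun_act h (g * g')%g = fun_act (fun_act h g) g'.
Proof. by apply/funext => x; rewrite /fun_act sg_actM. Qed.

Definition fun_module : rightModule (structure_group X) :=
  RightModule fun_actD fun_act1 fun_actM.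

Lemma fun_module_genE (h : fun_module) (y x : X) :
  rm_act h (sg_gen y) x = h (y ▷ x).
Proof. by rewrite /= /fun_act sg_act_gen. Qed.

End FunctionModule.

(* Main.v *)
(* A 1-cocycle p on G_X with values in Fun(X, A) is determined by its values   *)
(* on the generators, i.e. by f(x, z) = p(x)(z), and f extends to a cocycle    *)
(* exactly when it respects x y = (x ▷ y) x, that is                           *)
(*   f(x, y ▷ z) + f(y, z) = f(x ▷ y, x ▷ z) + f(x, z),                        *)
(* which is the rack 2-cocycle equation. Under this correspondence the         *)
(* coboundary of v : X -> A is f(x, z) = v(z) - v(x ▷ z) on both sides.        *)
From HB Require Import structures.
Require Import Defs.
From mathcomp Require Import all_boot all_algebra.

Set Implicit Arguments.
Unset Strict Implicit.
Unset Printing Implicit Defensive.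

Import GRing.Theory.
Local Open Scope ring_scope.
Local Open Scope quotient_scope.
Local Open Scope rack_scope.

(** The isomorphism comes from one additive map on cochains, [cocycle_ext], which extends a function
    on generators to words by the cocycle rule and evaluates it on a representative word. On rack
    2-cocycles the value does not depend on the word ([word_ext_congr]), so a group cocycle results;
    restriction to generators inverts it ([gen_restrK]), and coboundaries correspond in both
    directions ([cocycle_ext_coboundary]). Then [subquotient_iso] passes to classes. *)

Section SubquotientClass.
Variables (V : zmodType) (Z B : zmodClosed V).

Definition sq_class (u : subgroup_of Z) : subquotient Z B :=
  \pi_(Quotient.quot (@subgroup_rel V Z B)) u.

Lemma sq_class_eq u v : (sq_class u == sq_class v) = (val u - val v \in B).
Proof. by rewrite /sq_class -Quotient.idealrBE inE raddfB. Qed.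

Lemma sq_classB u v : sq_class (u - v) = sq_class u - sq_class v.
Proof. by rewrite /sq_class !piE. Qed.

Lemma sq_class_surj q : exists u, sq_class u = q.
Proof. by exists (repr q); rewrite /sq_class reprK. Qed.

End SubquotientClass.

Lemma subquotient_iso (V W : zmodType) (Z B : zmodClosed V)
    (Z' B' : zmodClosed W) (F : {additive V -> W}) :
    {in Z, forall v, F v \in Z'} ->
    {in Z, forall v, (F v \in B') = (v \in B)} ->
    {in Z', forall w, exists2 v, v \in Z & F v = w} ->
  exists phi : {additive subquotient Z B -> subquotient Z' B'}, bijective phi.
Proof.
move=> FZ FB Fsurj.
pose F' (u : subgroup_of Z) : subgroup_of Z' := SubgroupOf (FZ _ (valP u)).
pose phi (q : subquotient Z B) :=
  sq_class B' (F' (sval (cid (sq_class_surj q)))).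
(* Independence of the chosen representative is the implication from [B] to [B'] in [FB]; the
   converse gives injectivity below. *)
have phiE u : phi (sq_class B u) = sq_class B' (F' u).
  rewrite /phi; case: cid => v /= /eqP; rewrite sq_class_eq => uv.
  apply/eqP; rewrite sq_class_eq /= -raddfB FB //.
  by rewrite rpredB ?(valP v) ?(valP u).
have phiB : zmod_morphism phi.
  move=> p q; have [u <-] := sq_class_surj p; have [v <-] := sq_class_surj q.
  rewrite -sq_classB !phiE -sq_classB; congr sq_class.
  by apply: val_inj; rewrite /= !raddfB.
pose phiA := GRing.isZmodMorphism.Build _ _ phi phiB.
pose Phi : {additive _ -> _} := HB.pack phi phiA.
exists Phi.
have phi_inj : injective phi.
  move=> p q; have [u <-] := sq_class_surj p; have [v <-] := sq_class_surj q.
  rewrite !phiE => /eqP; rewrite sq_class_eq /= -raddfB FB => [uv|].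
    by apply/eqP; rewrite sq_class_eq.
  by rewrite rpredB ?(valP v) ?(valP u).
have phi_surj q : exists p, phi p = q.
  have [u <-] := sq_class_surj q.
  have [v Zv Fv] := Fsurj _ (valP u).
  exists (sq_class B (SubgroupOf Zv)); rewrite phiE; congr sq_class.
  exact: val_inj.
have [psi psiK] := choice phi_surj.
by exists psi => // p; apply: phi_inj; rewrite psiK.
Qed.

Section LowDegreeCochains.
Variables (X : rackType) (A : zmodType).

Definition pair2 (x y : X) : 'I_2 -> X := fun i => nth x [:: x; y] i.
Definition triple3 (x y z : X) : 'I_3 -> X := fun i => nth x [:: x; y; z] i.

Lemma pair2E (t : 'I_2 -> X) : t = pair2 (t ord0) (t ord_max).
Proof.
by apply/funext => -[[|[|//]] ?]; congr t; apply: val_inj.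
Qed.

Lemma triple3E (t : 'I_3 -> X) :
  t = triple3 (t ord0) (t (lift ord0 ord0)) (t ord_max).
Proof.
by apply/funext => -[[|[|[|//]]] ?]; congr t; apply: val_inj.
Qed.

Lemma rack_d1E (g : cochain X A 1) x y :
  rack_d g (pair2 x y) = g (fun=> y) - g (fun=> x ▷ y).
Proof.
rewrite /rack_d !big_ord_recl big_ord0 /= addr0.
have E0 : face0 ord0 (pair2 x y) = fun=> y.
  by apply/funext => -[[|//] ?].
have E1 : face1 ord0 (pair2 x y) = fun=> x ▷ y.
  by apply/funext => -[[|//] ?].
(* No entry lies to the right of the last one, so its two faces coincide and its term vanishes. *)
have E2 : face1 (lift ord0 ord0) (pair2 x y) =
          face0 (lift ord0 ord0) (pair2 x y).
  by apply/funext => -[[|//] ?].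
by rewrite E0 E1 E2 subrr mul0rz addr0.
Qed.

(** The terms are grouped by sign: the two sums are the values at [z] of the extension of [f] on the
    words [x y] and [(x ▷ y) x]. *)
Lemma rack_d2E (f : cochain X A 2) x y z :
  rack_d f (triple3 x y z) =
  f (pair2 x (y ▷ z)) + f (pair2 y z) -
  (f (pair2 (x ▷ y) (x ▷ z)) + f (pair2 x z)).
Proof.
rewrite /rack_d !big_ord_recl big_ord0 /= addr0.
have E0 : face0 ord0 (triple3 x y z) = pair2 y z.
  by apply/funext => -[[|[|//]] ?].
have E1 : face1 ord0 (triple3 x y z) = pair2 (x ▷ y) (x ▷ z).
  by apply/funext => -[[|[|//]] ?].
have E2 : face0 (lift ord0 ord0) (triple3 x y z) = pair2 x z.
  by apply/funext => -[[|[|//]] ?].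
have E3 : face1 (lift ord0 ord0) (triple3 x y z) = pair2 x (y ▷ z).
  by apply/funext => -[[|[|//]] ?].
have E4 : face0 (lift ord0 (lift ord0 ord0)) (triple3 x y z) = pair2 x y.
  by apply/funext => -[[|[|//]] ?].
have E5 : face1 (lift ord0 (lift ord0 ord0)) (triple3 x y z) = pair2 x y.
  by apply/funext => -[[|[|//]] ?].
rewrite E0 E1 E2 E3 E4 E5 subrr mul0rz addr0 expr0 mulr1z.
rewrite -[(-1) ^+ _]/(-1 : int) mulrNz mulr1z opprB opprD addrACA.
by rewrite [X in X + _]addrC.
Qed.

Lemma rack_cocycle2P (f : cochain X A 2) :
  f \in @rack_cocycle X A 2 <-> forall x y z,
    f (pair2 x (y ▷ z)) + f (pair2 y z) =
    f (pair2 (x ▷ y) (x ▷ z)) + f (pair2 x z).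
Proof.
split=> [/asboolP df x y z|df].
  by apply/eqP; rewrite -subr_eq0 -rack_d2E df.
by apply/asboolP/funext => t; rewrite [t]triple3E rack_d2E df subrr.
Qed.

Lemma rack_coboundary2P (f : cochain X A 2) :
  f \in @rack_coboundary X A 2 <-> exists v : X -> A, forall x z,
    f (pair2 x z) = v z - v (x ▷ z).
Proof.
split=> [/asboolP[g ->]|[v fE]].
  by exists (fun z => g (fun=> z)) => x z; rewrite rack_d1E.
apply/asboolP; exists (fun t => v (t ord0)).
by apply/funext => t; rewrite [t]pair2E rack_d1E fE.
Qed.

End LowDegreeCochains.

Section CocycleExtension.
Variables (X : rackType) (A : zmodType).
Implicit Types (f : cochain X A 2) (w : seq (bool * X)).
Local Notation G := (structure_group X).
Local Notation M := (fun_module X A).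

(* The value on x^-1 is forced by p (x * x^-1) = 0. *)
Definition letter_ext f (l : bool * X) (z : X) : A :=
  if l.1 then f (pair2 l.2 z) else - f (pair2 l.2 (rinv l.2 z)).

(** This unrolls p(gh) = p(g)·h + p(h): each letter is evaluated where the suffix after it has moved
    [z]. *)
Fixpoint word_ext f w (z : X) : A :=
  if w is l :: w' then letter_ext f l (word_act w' z) + word_ext f w' z else 0.

Lemma word_ext_cat f u v z :
  word_ext f (u ++ v) z = word_ext f u (word_act v z) + word_ext f v z.
Proof.
elim: u => [|l u IHu] /=; first by rewrite add0r.
by rewrite IHu addrA /word_act foldr_cat.
Qed.

(** The cocycle equation is exactly invariance under [SgRack]; [SgCancel] holds by the choice of
    [letter_ext], and [SgCat] because congruent words act alike on X. *)
Lemma word_ext_congr f u v : f \in @rack_cocycle X A 2 ->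
  sg_congr u v -> word_ext f u =1 word_ext f v.
Proof.
move=> /rack_cocycle2P fZ.
elim=> {u v} [||u v w _ uv _ vw z|u u' v v' _ uu' vc vv' z|b x z|x y z] //.
- by move=> u v _ uv z.
- by rewrite uv vw.
- by rewrite !word_ext_cat vv' uu' (word_act_congr vc).
- by case: b; rewrite /= /letter_ext /= addr0 ?ropK ?subrr ?addNr.
- by rewrite /= /letter_ext /= !addr0 fZ.
Qed.

Definition cocycle_ext f : G -> M := fun g => word_ext f (sg_word g).

Lemma cocycle_extE f w : f \in @rack_cocycle X A 2 ->
  cocycle_ext f (sg_class w) =1 word_ext f w.
Proof. by move=> fZ; apply: word_ext_congr => //; exact: sg_congr_word. Qed.

Lemma cocycle_ext_gen f x z : f \in @rack_cocycle X A 2 ->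
  cocycle_ext f (sg_gen x) z = f (pair2 x z).
Proof. by move=> fZ; rewrite cocycle_extE //= /letter_ext /= addr0. Qed.

Lemma cocycle_ext_additive : zmod_morphism cocycle_ext.
Proof.
move=> f f'; apply/funext => g; apply/funext => z.
rewrite -[RHS]/(cocycle_ext f g z - cocycle_ext f' g z) /cocycle_ext.
elim: (sg_word g) => [|[b x] w IHw] /=; first by rewrite subrr.
rewrite IHw opprD addrACA; congr (_ + _); case: b => //=.
by rewrite /letter_ext /= -[(f - f') _]/(f _ - f' _) opprD.
Qed.
HB.instance Definition _ :=
  GRing.isZmodMorphism.Build (cochain X A 2) (G -> M)
    cocycle_ext cocycle_ext_additive.

Lemma cocycle_ext_cocycle :
  {in @rack_cocycle X A 2, forall f, cocycle_ext f \in @group_cocycle1 G M}.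
Proof.
move=> f fZ; apply/asboolP => g h; apply/funext => z.
by rewrite [LHS]cocycle_extE // word_ext_cat.
Qed.

(** The sum telescopes along the images of [z] under the suffixes of [w]. *)
Lemma word_ext_coboundary f (v : X -> A) w z :
    (forall x t, f (pair2 x t) = v t - v (x ▷ t)) ->
  word_ext f w z = v z - v (word_act w z).
Proof.
move=> fE; elim: w => [|[b x] w IHw] /=; first by rewrite subrr.
rewrite IHw /letter_ext /= !fE rinvK opprB.
by case: b; rewrite addrC addrA subrK.
Qed.

Lemma cocycle_ext_coboundary : {in @rack_cocycle X A 2, forall f,
  (cocycle_ext f \in @group_coboundary1 G M) = (f \in @rack_coboundary X A 2)}.
Proof.
move=> f fZ; apply/idP/idP => [/asboolP[v fE]|/rack_coboundary2P[v fE]].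
  apply/rack_coboundary2P; exists v => x z.
  by rewrite -cocycle_ext_gen // fE -fun_module_genE.
apply/asboolP; exists v => g; apply/funext => z.
(* The extension and the action of [g] are both computed on [sg_word g], so the telescoped formula
   applies by conversion. *)
exact: word_ext_coboundary.
Qed.

Lemma group_cocycle1_mul (p : G -> M) g h z : p \in @group_cocycle1 G M ->
  p (g * h)%g z = p g (sg_act h z) + p h z.
Proof. by move=> /asboolP ->. Qed.

Lemma group_cocycle1_one (p : G -> M) z : p \in @group_cocycle1 G M ->
  p 1%g z = 0.
Proof.
move=> pZ; apply: (addIr (p 1%g z)).
by rewrite add0r -{1}[z]sg_act1 -group_cocycle1_mul // mulg1.
Qed.

Definition gen_restr (p : G -> M) : cochain X A 2 :=
  fun t => p (sg_gen (t ord0)) (t ord_max).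

(** Evaluate [p] on both sides of the defining relation [sg_gen_rel]. *)
Lemma gen_restr_cocycle (p : G -> M) : p \in @group_cocycle1 G M ->
  gen_restr p \in @rack_cocycle X A 2.
Proof.
move=> pZ; apply/rack_cocycle2P => x y z; rewrite /gen_restr /=.
rewrite -(sg_act_gen y z) -(sg_act_gen x z).
by rewrite -!group_cocycle1_mul // sg_gen_rel.
Qed.

Lemma gen_restrK (p : G -> M) : p \in @group_cocycle1 G M ->
  cocycle_ext (gen_restr p) = p.
Proof.
move=> pZ; apply/funext => g; apply/funext => z.
rewrite /cocycle_ext -[in RHS](sg_wordK g).
elim: (sg_word g) => [|[b x] w IHw] /=.
  exact: esym (group_cocycle1_one z pZ).
rewrite IHw -cat1s -sg_mulE [RHS]group_cocycle1_mul // sg_actE.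
congr (_ + _); rewrite /letter_ext /gen_restr; case: b => //=.
(* For an inverse letter, the value is forced by p(x x^-1) = p(1) = 0 at [t]. *)
set t := word_act w z; apply/eqP; rewrite eq_sym -addr_eq0; apply/eqP.
have -> : rinv x t = sg_act (sg_class [:: (false, x)]) t by rewrite sg_actE.
rewrite addrC -group_cocycle1_mul // -[RHS](group_cocycle1_one t pZ).
congr (p _ t); rewrite [LHS]sg_mulE; apply/sg_classP; exact: SgCancel.
Qed.

End CocycleExtension.

Theorem corollary5p4 (X : rackType) (A : zmodType) :
  exists phi : {additive rack_cohomology X A 2 -> group_H1 (fun_module X A)},
    bijective phi.
Proof.
apply: (@subquotient_iso _ _ _ _ _ _ (@cocycle_ext X A)).
- exact: cocycle_ext_cocycle.
- exact: cocycle_ext_coboundary.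
- move=> p pZ; exists (gen_restr p); first exact: gen_restr_cocycle.
  exact: gen_restrK.
Qed.
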